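(* Fix a scenario $s\in S$, a shipper $n\in N$, a customer category $k\in K_n$, a service level $m\in M_{nk}$ and a price level $p\in P_n^m$. Suppose the leader's first-stage assignments $\mathbf{z}$ and $\mathbf{y}$ lead to $U_{nks}^m(\mathbf{y};\varepsilon_{nks}^m)<U_{nks}^0(\varepsilon_{nks}^0)$. Then every feasible solution $(x,w)$ of the second-stage problem for scenario $s$ (see context) satisfies $$\big(U_{nks}^m(\mathbf{y};\varepsilon_{nks}^m)-U_{nks}^0(\varepsilon_{nks}^0)\big)\,x_{nks}^m=0,$$ $$d_k\,q_n^{mp}\,x_{nks}^m\,y_n^{mp}-\sum_{i\in I}\ \sum_{j\in J'_n\cap J_k}c_{ij}^m\,w_{ijs}^m=0.$$
   Context: A logistics provider (LP, the leader) makes offers to a finite set $N$ of shippers (followers). $J$ is the finite set of customers; $J'_n\subseteq J$ is the set of customers of shipper $n$; $K_n$ is the finite set of customer categories of shipper $n$, and $J_k$ is the set of customers in category $k\in K_n$. $I$ is a finite set of facility locations. $M_n$ is the finite set of service levels available for shipper $n$, and $M_{nk}\subseteq M_n$ is the set of those available for shipper $n$ and category $k$ (also written $M_k$); the opt-out alternative is $0\notin M_{nk}$, and $M_{nk}^0=M_{nk}\cup\{0\}$. For a customer $j$, $M_j$ is the set of service levels $m$ such that $j\in J_k$ and $m\in M_k$ for some category $k$. $P_n^m$ is the finite set of price levels for shipper $n$ and service level $m$, with prices $q_n^{mp}$; $P_n^0=\emptyset$. Parameters: customer demands $d_j$, $d_k=\sum_{j\in J_k}d_j$; assignment costs $c_{ij}^m$;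 facility capacities $u_i$; capacity-usage factors $\gamma^m\ge 1$; minimum demand levels $l_n^{mp}$. First-stage (leader) decisions, fixed here: $r_i\in\{0,1\}$ (facility $i$ is opened); $y_n^{mp}\in\{0,1\}$ (price level $p$ is offered to shipper $n$ for service level $m$); $z_{nk}^m\in\{0,1\}$ (service level $m$ is assigned to shipper $n$ and category $k$). They satisfy $\sum_{p\in P_n^m}y_n^{mp}\le 1$ ($n\in N$, $m\in M_n$), $\sum_{m\in M_n}\sum_{p\in P_n^m}y_n^{mp}\le |K_n|$ ($n\in N$), $\sum_{m\in M_{nk}}z_{nk}^m\le 1$ ($n\in N,k\in K_n$), and $z_{nk}^m\le\sum_{p\in P_n^m}y_n^{mp}$ ($n\in N,k\in K_n,m\in M_n$). Utilities in scenario $s$: $U_{nks}^m(\mathbf{y};\varepsilon_{nks}^m)=\alpha\big(\sum_{p\in P_n^m}q_n^{mp}y_n^{mp}\big)+L_{nk}^m+\varepsilon_{nks}^m$ for $m\in M_{nk}$, and $U_{nks}^0(\varepsilon_{nks}^0)=L_{nk}^0+\varepsilon_{nks}^0$, where $\alpha$, $L_{nk}^m$ are real parameters and $\varepsilon_{nks}^m$ is the realization in scenario $s$ of a real random noise term. $S$ is a finite set of scenarios. Second-stage problem for scenario $s$: maximize $$\sum_{n\in N}\sum_{k\in K_n}\sum_{m\in M_k}\sum_{p\in P_n^m}d_kq_n^{mp}x_{nks}^my_n^{mp}-\sum_{i\in I}\sum_{j\in J}\sum_{m\in M_j}c_{ij}^mw_{ijs}^m$$ over $(x,w)$ subject to: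 (1) $\sum_{j\in J}\sum_{m\in M_j}w_{ijs}^m\gamma^md_j\le u_ir_i$ for $i\in I$; (2) $\sum_{m\in M_j}w_{ijs}^m\le r_i$ for $i\in I$, $j\in J_i$ (where $J_i\subseteq J$ is a given set of customers associated with facility $i$); (3) $\sum_{i\in I}w_{ijs}^m=x_{nks}^m$ for $n\in N$, $k\in K_n$, $j\in J_k$, $m\in M_j$; (4) $\sum_{k\in K_n}d_kx_{nks}^m\ge\sum_{p\in P_n^m}l_n^{mp}y_n^{mp}$ for $n\in N$, $m\in M_n$; (5) for each $n\in N$, $k\in K_n$, the vector $(x_{nks}^m)_{m\in M_{nk}^0}$ is an optimal solution of the follower's problem: maximize $\sum_{m\in M_{nk}^0}U_{nks}^m\,x_{nks}^m$ subject to $\sum_{m\in M_{nk}^0}x_{nks}^m=1$, $x_{nks}^m\le z_{nk}^m$ for $m\in M_{nk}$, and $x_{nks}^m\in\{0,1\}$ for $m\in M_{nk}^0$; (6) $0\le w_{ijs}^m\le 1$ for $i\in I$, $j\in J$, $m\in M_j$. *)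

(* Defs.v *)
From HB Require Import structures.
From mathcomp Require Import all_boot all_order all_algebra.

Set Implicit Arguments.
Unset Strict Implicit.
Unset Printing Implicit Defensive.

Import Order.TTheory GRing.Theory Num.Theory.
Local Open Scope ring_scope.

Record max_problem (R : realFieldType) (X : Type) := MaxProblem {
  objective : X -> R;
  feasible : X -> Prop
}.

Definition optimal (R : realFieldType) (X : Type) (Q : max_problem R X)
    (x : X) : Prop :=
  feasible Q x /\ forall x', feasible Q x' -> objective Q x' <= objective Q x.

(* The index sets of shippers N, facilities I, customers J and scenarios S are
   the types themselves.  K, M and P are universes containing all the
   categories, alternatives (service levels and opt-out) and price levels; the
   shipper-dependent sets are finite subsets of them. *)
Record instance (R : realFieldType) (N I J K M P S : finType) := Instance {
  opt_out : M;                       (* the alternative 0 *)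
  shipper_customers : N -> {set J};  (* J'_n *)
  categories : N -> {set K};         (* K_n *)
  cat_customers : K -> {set J};      (* J_k *)
  facility_customers : I -> {set J}; (* J_i *)
  levels : N -> {set M};             (* M_n *)
  cat_levels : N -> K -> {set M};    (* M_nk, also written M_k *)
  prices : N -> M -> {set P};        (* P_n^m *)
  price : N -> M -> P -> R;          (* q_n^mp *)
  demand : J -> R;                   (* d_j *)
  cost : I -> J -> M -> R;           (* c_ij^m *)
  capacity : I -> R;                 (* u_i *)
  usage : M -> R;                    (* gamma^m *)
  min_demand : N -> M -> P -> R;     (* l_n^mp *)
  alpha : R;
  intercept : N -> K -> M -> R;      (* L_nk^m, including L_nk^0 *)
  noise : N -> K -> S -> M -> R      (* eps_nks^m, including eps_nks^0 *)
}.

Record well_formed (R : realFieldType) (N I J K M P S : finType)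
    (D : instance R N I J K M P S) : Prop := WellFormed {
  cat_levels_sub : forall n k, k \in categories D n ->
    cat_levels D n k \subset levels D n;
  opt_out_notin : forall n k, k \in categories D n ->
    opt_out D \notin cat_levels D n k;
  prices_opt_out : forall n, prices D n (opt_out D) = set0;
  usage_ge1 : forall n m, m \in levels D n -> 1 <= usage D m
}.

Section Model.

Variables (R : realFieldType) (N I J K M P S : finType).
Variable D : instance R N I J K M P S.

(* M_nk^0 *)
Definition alternatives (n : N) (k : K) : {set M} :=
  opt_out D |: cat_levels D n k.

(* M_j; "some category" means a category of some shipper. *)
Definition customer_levels (j : J) : {set M} :=
  [set m | [exists n, exists k,
    [&& k \in categories D n, j \in cat_customers D k
      & m \in cat_levels D n k]]].

(* d_k *)
Definition cat_demand (k : K) : R := \sum_(j in cat_customers D k) demand D j.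

Record first_stage_feasible (y : N -> M -> P -> bool) (z : N -> K -> M -> bool)
    : Prop := FirstStageFeasible {
  one_price : forall n m, m \in levels D n ->
    (\sum_(p in prices D n m) y n m p <= 1)%N;
  offers_bound : forall n,
    (\sum_(m in levels D n) \sum_(p in prices D n m) y n m p
       <= #|categories D n|)%N;
  one_level : forall n k, k \in categories D n ->
    (\sum_(m in cat_levels D n k) z n k m <= 1)%N;
  level_offered : forall n k m, k \in categories D n -> m \in levels D n ->
    (z n k m <= \sum_(p in prices D n m) y n m p)%N
}.

Definition utility (y : N -> M -> P -> bool) (s : S) (n : N) (k : K) (m : M)
    : R :=
  if m == opt_out D then intercept D n k m + noise D n k s m
  else alpha D * (\sum_(p in prices D n m) price D n m p * (y n m p)%:R)
       + intercept D n k m + noise D n k s m.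

(* A decision vector is a function on all of M of which only the coordinates in
   M_nk^0 are constrained or enter the objective. *)
Definition follower_problem (y : N -> M -> P -> bool) (z : N -> K -> M -> bool)
    (s : S) (n : N) (k : K) : max_problem R (M -> R) :=
  MaxProblem
    (fun x => \sum_(m in alternatives n k) utility y s n k m * x m)
    (fun x => [/\ \sum_(m in alternatives n k) x m = 1,
                  forall m, m \in cat_levels D n k -> x m <= (z n k m)%:R
                & forall m, m \in alternatives n k -> x m = 0 \/ x m = 1]).

(* The variables x_nks^m and w_ijs^m of one fixed scenario s; here too they are
   total functions, constrained only on the index ranges of the model. *)
Record second_stage_feasible (r : I -> bool) (y : N -> M -> P -> bool)
    (z : N -> K -> M -> bool) (s : S)
    (xw : (N -> K -> M -> R) * (I -> J -> M -> R)) : Prop :=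
  SecondStageFeasible {
  facility_capacity : forall i,
    \sum_j \sum_(m in customer_levels j) xw.2 i j m * usage D m * demand D j
      <= capacity D i * (r i)%:R;
  facility_open : forall i j, j \in facility_customers D i ->
    \sum_(m in customer_levels j) xw.2 i j m <= (r i)%:R;
  assignment : forall n k j m, k \in categories D n ->
    j \in cat_customers D k -> m \in customer_levels j ->
    \sum_i xw.2 i j m = xw.1 n k m;
  demand_met : forall n m, m \in levels D n ->
    \sum_(p in prices D n m) min_demand D n m p * (y n m p)%:R
      <= \sum_(k in categories D n) cat_demand k * xw.1 n k m;
  follower_optimal : forall n k, k \in categories D n ->
    optimal (follower_problem y z s n k) (xw.1 n k);
  assignment_range : forall i j m, m \in customer_levels j ->
    0 <= xw.2 i j m <= 1
}.

Definition second_stage_problem (r : I -> bool) (y : N -> M -> P -> bool)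
    (z : N -> K -> M -> bool) (s : S)
    : max_problem R ((N -> K -> M -> R) * (I -> J -> M -> R)) :=
  MaxProblem
    (fun xw =>
       \sum_n \sum_(k in categories D n) \sum_(m in cat_levels D n k)
         \sum_(p in prices D n m)
           cat_demand k * price D n m p * xw.1 n k m * (y n m p)%:R
       - \sum_i \sum_j \sum_(m in customer_levels j)
           cost D i j m * xw.2 i j m)
    (second_stage_feasible r y z s).

End Model.

(* Main.v *)
Require Import Defs.
From HB Require Import structures.
From mathcomp Require Import all_boot all_order all_algebra.

(** Given the prices, the follower of category [k] picks exactly one
    alternative, and the opt-out is always among the admissible ones because no
    assignment variable bounds it.  An alternative of utility below the opt-out
    is therefore never part of an optimal choice ([inferior_level_rejected]), so
    [x n k m = 0].  This kills the utility-gap product and the revenue term.  By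
    the assignment constraint, the nonnegative flows serving a customer of
    category [k] at level [m] sum to [x n k m], so they all vanish
    ([unused_level_no_flow]), and with them the assignment cost. *)

Import Order.TTheory GRing.Theory Num.Theory.
Local Open Scope ring_scope.

Set Implicit Arguments.
Unset Strict Implicit.

(** Nonnegativity leaves nothing for the other coordinates once one of them
    takes the whole unit of mass. *)
Lemma sum_binary_choice (R : realFieldType) (T : finType) (A : {set T})
    (f x : T -> R) (a : T) :
    a \in A -> x a = 1 -> \sum_(b in A) x b = 1 ->
    (forall b, b \in A -> x b = 0 \/ x b = 1) ->
  \sum_(b in A) f b * x b = f a.
Proof.
move=> aA xa1 sum1 bin.
have rest0 : \sum_(b in A | b != a) x b = 0.
  by apply: (addrI 1); rewrite addr0 -{1}xa1 -sum1 [RHS](bigD1 a).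
have x_ge0 b : (b \in A) && (b != a) -> 0 <= x b.
  by case/andP=> /bin [] -> _.
rewrite (bigD1 a) //= xa1 mulr1 big1 ?addr0 // => b bAa.
by rewrite (psumr_eq0P x_ge0 rest0) ?mulr0.
Qed.

Section SecondStage.

Variables (R : realFieldType) (N I J K M P S : finType).
Variable D : instance R N I J K M P S.
Variables (y : N -> M -> P -> bool) (z : N -> K -> M -> bool).

Lemma opt_out_alternative n k : opt_out D \in alternatives D n k.
Proof. exact: setU11. Qed.

Lemma opt_out_feasible (s : S) n k :
    opt_out D \notin cat_levels D n k ->
  feasible (follower_problem D y z s n k) (fun m => (m == opt_out D)%:R).
Proof.
move=> out; split=> [|m mk|m _].
- rewrite (bigD1 _ (opt_out_alternative n k)) /= eqxx big1 ?addr0 // => m.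
  by case/andP=> _ /negbTE ->.
- have /negbTE -> : m != opt_out D by apply: contraNneq out => <-.
  exact: ler0n.
- by case: eqP => _; [right | left].
Qed.

(** If the follower selected [m], the objective would be the utility of [m],
    and opting out would be strictly better. *)
Lemma inferior_level_rejected (s : S) n k m (x : M -> R) :
    opt_out D \notin cat_levels D n k -> m \in cat_levels D n k ->
    utility D y s n k m < utility D y s n k (opt_out D) ->
    optimal (follower_problem D y z s n k) x ->
  x m = 0.
Proof.
move=> out mk Ult [[sum1 _ bin] opt].
have mA : m \in alternatives D n k by apply: setU1r.
have [//|xm1] := bin m mA.
have [sum1' _ bin'] := opt_out_feasible s out.
have := opt _ (opt_out_feasible s out); rewrite /=.
rewrite (sum_binary_choice _ mA xm1 sum1 bin).
rewrite (sum_binary_choice _ (opt_out_alternative n k) _ sum1' bin') ?eqxx //.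
by rewrite leNgt Ult.
Qed.

Lemma unused_level_no_flow (r : I -> bool) (s : S) n k m i j x w :
    second_stage_feasible D r y z s (x, w) ->
    k \in categories D n -> m \in cat_levels D n k ->
    j \in cat_customers D k -> x n k m = 0 ->
  w i j m = 0.
Proof.
move=> feas kn mk jk x0.
have mj : m \in customer_levels D j.
  by rewrite inE; apply/existsP; exists n; apply/existsP; exists k; apply/and3P.
have w_ge0 i' : true -> 0 <= w i' j m.
  by move=> _; case/andP: (assignment_range feas i' mj).
have sum0 : \sum_i' w i' j m = 0.
  by have /= -> := assignment feas kn jk mj.
exact: (psumr_eq0P w_ge0 sum0).
Qed.

End SecondStage.

Unset Implicit Arguments.
Set Strict Implicit.

Theorem proposition2 (R : realFieldType) (N I J K M P S : finType)
    (D : instance R N I J K M P S) (hD : well_formed D)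
    (r : I -> bool) (y : N -> M -> P -> bool) (z : N -> K -> M -> bool)
    (hyz : first_stage_feasible D y z)
    (s : S) (n : N) (k : K) (hk : k \in categories D n)
    (m : M) (hm : m \in cat_levels D n k)
    (p : P) (hp : p \in prices D n m)
    (hU : utility D y s n k m < utility D y s n k (opt_out D)) :
  forall (x : N -> K -> M -> R) (w : I -> J -> M -> R),
    feasible (second_stage_problem D r y z s) (x, w) ->
    (utility D y s n k m - utility D y s n k (opt_out D)) * x n k m = 0 /\
    cat_demand D k * price D n m p * x n k m * (y n m p)%:R
      - \sum_i \sum_(j in shipper_customers D n :&: cat_customers D k)
          cost D i j m * w i j m = 0.
Proof.
move=> x w feas.
have x0 : x n k m = 0.
  exact: inferior_level_rejected (opt_out_notin hD hk) hm hU
    (follower_optimal feas hk).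
split; first by rewrite x0 mulr0.
rewrite x0 mulr0 mul0r sub0r big1 ?oppr0 // => i _.
rewrite big1 // => j /setIP[_ jk].
by rewrite (unused_level_no_flow i feas hk hm jk x0) mulr0.
Qed.
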